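(* Let $r>0$ and let $P$ be the uniform distribution on the circle $x_1^2+x_2^2=r^2$ in $\mathbb{R}^2$. Then for every $n\in\mathbb{N}$, $n\ge1$, the set $$\alpha_n:=\Big\{\frac{nr}{\pi}\Big(\sin\frac{\pi}{n}\cdot\cos\Big((2j-1)\frac{\pi}{n}\Big),\ \sin\frac{\pi}{n}\cdot\sin\Big((2j-1)\frac{\pi}{n}\Big)\Big) : j=1,2,\dots,n\Big\}$$ forms an optimal set of $n$-means for $P$, and the corresponding quantization error is given by $$V_n=r^2\Big(1-\frac{n^2}{\pi^2}\sin^2\frac{\pi}{n}\Big).$$
   Context: The uniform distribution $P$ on the circle is normalized arc length: $dP=\frac{1}{2\pi}\,d\theta$ in the parametrization $\theta\mapsto(r\cos\theta,r\sin\theta)$, $0\le\theta\le2\pi$. Let $d$ be the Euclidean distance on $\mathbb{R}^2$. The $n$th (unconstrained, unconditional) quantization error of $P$ is $$V_n=V_n(P)=\inf\Big\{\int\min_{a\in\alpha}d(x,a)^2\,dP(x) : \alpha\subseteq\mathbb{R}^2,\ 1\le\mathrm{card}(\alpha)\le n\Big\},$$ and a set $\alpha$ attaining this infimum is called an optimal set of $n$-means for $P$. *)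

(* Defs.v *)
From HB Require Import structures.
From mathcomp Require Import all_boot all_order all_algebra finmap.
From mathcomp Require Import all_classical all_reals all_analysis.
From mathcomp Require Import measurable_realfun.
Import Order.TTheory GRing.Theory Num.Theory.
Import numFieldNormedType.Exports.

Set Implicit Arguments.
Unset Strict Implicit.
Unset Printing Implicit Defensive.

Local Open Scope classical_set_scope.
Local Open Scope ring_scope.

Section Plane.
Context {R : realType}.

(* The library's norm on the product R * R is the sup norm, so the Euclidean
   distance is defined explicitly. *)
Definition eucl_dist (x y : R * R) : R :=
  Num.sqrt ((x.1 - y.1) ^+ 2 + (x.2 - y.2) ^+ 2).

(* +oo is the neutral element of the minimum; for nonempty [A] the value is the
   finite minimum over [A]. *)
Definition min_sq_dist (A : {fset R * R}) (x : R * R) : \bar R :=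
  \big[mine/+oo%E]_(a <- A) (eucl_dist x a ^+ 2)%:E.

Definition distortion (P : probability (R * R)%type R) (A : {fset R * R}) :
    \bar R :=
  (\int[P]_x min_sq_dist A x)%E.

Definition quantization_error (P : probability (R * R)%type R) (n : nat) :
    \bar R :=
  ereal_inf [set distortion P A
            | A in [set A : {fset R * R} | (1 <= #|` A| <= n)%N]].

Definition optimal_n_means (P : probability (R * R)%type R) (n : nat)
    (A : {fset R * R}) : Prop :=
  (1 <= #|` A| <= n)%N /\ distortion P A = quantization_error P n.

End Plane.

Section Circle.
Context {R : realType} (r : R).

Definition circle_param (theta : measurableTypeR R) : R * R := (r * cos theta, r * sin theta).

Lemma measurable_circle_param : measurable_fun [set: measurableTypeR R] circle_param.
Proof.
apply/measurable_fun_pairP; split => /=; apply: measurable_funM => //.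
- by apply: continuous_measurable_fun; exact: continuous_cos.
- by apply: continuous_measurable_fun; exact: continuous_sin.
Qed.

HB.instance Definition _ :=
  isMeasurableFun.Build _ _ _ _ circle_param measurable_circle_param.

Lemma two_pi_gt0 : 0 < 2 * pi :> R.
Proof. by rewrite mulr_gt0// pi_gt0. Qed.

(* Law of [circle_param theta] for [theta] uniform on [0, 2 pi]. *)
Definition circle_uniform : probability (R * R)%type R :=
  distribution (uniform_prob two_pi_gt0) circle_param.

End Circle.

Definition circle_mean {R : realType} (r : R) (n j : nat) : R * R :=
  (n%:R * r / pi * (sin (pi / n%:R) * cos ((2 * j%:R - 1) * (pi / n%:R))),
   n%:R * r / pi * (sin (pi / n%:R) * sin ((2 * j%:R - 1) * (pi / n%:R)))).

Definition circle_means {R : realType} (r : R) (n : nat) : {fset R * R} :=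
  [fset circle_mean r n j | j in iota 1 n]%fset.

(* Main.v *)
(* Put h = pi / n and s = sin h / h.  For every level lam,
     min_a d(x, a)^2 >= lam - \sum_a (lam - d(x, a)^2)^+,
   so it suffices to bound the integral of each (lam - d(x, a)^2)^+ over the
   circle separately.  For n >= 2 take as lam the value r^2 (1 + s^2 - 2 s cos h)
   of the optimal configuration at the boundary of an arc.  The positive part
   attached to a = r rho u is supported on an arc of half-angle t centered at u;
   maximizing first over rho and then over t shows that its integral is largest
   at t = h, rho = s, which is exactly one cell of the configuration circle_means,
   and the n bounds add up to the claimed value.  The case n = 1 is a direct
   computation. *)
Require Import Defs.
From mathcomp Require Import all_boot all_order all_algebra finmap.
From mathcomp Require Import all_classical all_reals all_analysis.
From mathcomp Require Import measurable_realfun ring lra.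
Import Order.TTheory GRing.Theory Num.Theory.
Import numFieldNormedType.Exports.

Local Open Scope classical_set_scope.
Local Open Scope ring_scope.

(** * Trigonometric inequalities and the gain of a single cell *)

Section Trigonometry.
Context {R : realType}.
Implicit Types t h u : R.

Lemma sin_mvt (a b : R) : a < b ->
  exists2 x, a < x < b & sin b - sin a = cos x * (b - a).
Proof.
move=> ab.
have [|x] := @MVT R (@sin R) (@cos R) a b ab (fun x _ => is_derive_sin x).
  by apply: continuous_subspaceT => x; exact: continuous_sin.
by rewrite in_itv/= => xab ->; exists x.
Qed.

Lemma ler_cos_0pi t u : 0 <= t -> t <= u -> u <= pi -> cos u <= cos t.
Proof.
move=> t0; rewrite le_eqVlt => /predU1P[->//|tu] upi; apply: ltW.
rewrite ltr_cos// in_itv/= ?(ltW (le_lt_trans t0 tu)) ?t0 ?upi//.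
by rewrite (le_trans (ltW tu) upi).
Qed.

Lemma sin_le_id t : 0 <= t -> sin t <= t.
Proof.
rewrite le_eqVlt => /predU1P[<-|t0]; first by rewrite sin0.
have [x _] := sin_mvt _ _ t0; rewrite sin0 !subr0 => ->.
by rewrite ler_piMl ?cos_le1// ltW.
Qed.

Lemma mul_cos_le_sin t : 0 < t -> t <= pi -> t * cos t <= sin t.
Proof.
move=> t0 tpi.
have [x /andP[x0 xt]] := sin_mvt _ _ t0; rewrite sin0 !subr0 => ->.
by rewrite mulrC ler_pM2r// ler_cos_0pi// ltW.
Qed.

(* The chords of [sin] over [0, u] and [u, pi / 2] have slopes [cos x >= cos y]
   with [x < u < y]. *)
Lemma jordan_sin u : 0 <= u -> u <= pi / 2 -> 2 / pi * u <= sin u.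
Proof.
have p0 := @pi_gt0 R.
rewrite le_eqVlt => /predU1P[<-|u0]; first by rewrite mulr0 sin0.
rewrite le_eqVlt => /predU1P[->|u2].
  by rewrite sin_pihalf -invf_div mulVf// lt0r_neq0// divr_gt0.
have [x /andP[x0 xu]] := sin_mvt _ _ u0; rewrite sin0 !subr0 => sx.
have [y /andP[uy y2]] := sin_mvt _ _ u2; rewrite sin_pihalf => sy.
have cyx : cos y <= cos x.
  by apply: ler_cos_0pi; [exact: ltW|exact/ltW/(lt_trans xu)|lra].
have : u * (1 - sin u) <= (pi / 2 - u) * sin u.
  rewrite sy sx; have : 0 <= u * (pi / 2 - u) by rewrite mulr_ge0// ?subr_ge0 ltW.
  by move=> /ler_wpM2l => /(_ _ _ cyx); lra.
move=> H; rewrite mulrAC ler_pdivrMr//; lra.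
Qed.

(** The right-hand side is the tangent line at [pi / 2] of [sin t ^+ 2 / t]. Multiplied by [t] it
    becomes [1 - (2 / pi * (t - pi / 2)) ^+ 2], and Jordan's inequality at [t - pi / 2] bounds the
    square by [cos t ^+ 2]. *)
Lemma sqr_sin_le t : pi / 2 <= t -> t <= pi ->
  sin t ^+ 2 / t <= 4 / pi ^+ 2 * (pi - t).
Proof.
move=> t2 tpi; have p0 := @pi_gt0 R.
have t0 : 0 < t by rewrite (lt_le_trans _ t2)// divr_gt0.
rewrite ler_pdivrMr//.
have u0 : 0 <= t - pi / 2 by lra.
have /(jordan_sin _ u0) : t - pi / 2 <= pi / 2 by lra.
rewrite sinBpihalf => H.
have : (2 / pi * (t - pi / 2)) ^+ 2 <= (- cos t) ^+ 2.
  have L0 : 0 <= 2 / pi * (t - pi / 2) by rewrite mulr_ge0// divr_ge0// ltW.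
  by rewrite ler_sqr// nnegrE// (le_trans L0).
rewrite sin2cos2 sqrrN => H'.
have -> : 4 / pi ^+ 2 * (pi - t) * t = 1 - (2 / pi * (t - pi / 2)) ^+ 2.
  by move: (@pi R) p0 => p p0; field; exact: lt0r_neq0.
lra.
Qed.

Definition sinc t : R := sin t / t.

Lemma is_derive_sinc t : t != 0 ->
  is_derive t 1 sinc ((cos t - sinc t) / t).
Proof.
move=> t0.
have Dv : is_derive t (1 : R) (fun y : R => y^-1) (- t ^- 2 *: (1 : R)).
  exact: (@is_deriveV R id).
have D := is_deriveM (is_derive_sin t) Dv.
by apply: is_derive_eq; rewrite /sinc /GRing.scale/=; field.
Qed.

(* On an arc of half-angle [t], [2 * rho * sin t - rho ^+ 2 * t] has maximum
   [gain t] over [rho], attained at [rho = sinc t]. *)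
Definition gain t : R := sin t * sinc t.
(** Away from 0 this is the derivative of [gain]. It also acts as a multiplier: the level [lam] is
    [r ^+ 2 * (1 - gain' h)], which makes [gain t - gain' h * t] stationary at [t = h]. *)
Definition gain' t : R := 2 * sinc t * cos t - sinc t ^+ 2.

Lemma is_derive_gain t : t != 0 -> is_derive t 1 gain (gain' t).
Proof.
move=> t0; have Ds := is_derive_sinc _ t0.
have D := is_deriveM (is_derive_sin t) Ds.
by apply: is_derive_eq; rewrite /gain' /GRing.scale/= /sinc; field.
Qed.

Lemma is_derive_gain' t : t != 0 ->
  is_derive t 1 gain' (2 / t * ((sinc t - cos t) ^+ 2 - sin t ^+ 2)).
Proof.
move=> t0; have Ds := is_derive_sinc _ t0.
have D1 := is_deriveM (is_deriveZ (2:R) Ds) (is_derive_cos t).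
have D := is_deriveB D1 (is_deriveX 2 Ds).
by apply: is_derive_eq; rewrite /= /GRing.scale/= /sinc; field.
Qed.

(** The derivative formulas for [gain] and [gain'] are available away from 0 only, hence the
    restriction to positive intervals. *)
Lemma mvt_gt0 (f df : R -> R) (a b : R) :
  (forall x : R, x != 0 -> is_derive x 1 f (df x)) -> 0 < a -> a < b ->
  exists2 x, a < x < b & f b - f a = df x * (b - a).
Proof.
move=> Df a0 ab.
have neq0 x : a <= x -> x != 0 by move=> ax; rewrite gt_eqF// (lt_le_trans a0).
have [x||x] := @MVT R f df a b ab.
- by rewrite in_itv/= => /andP[ax _]; exact/Df/neq0/ltW.
- apply: derivable_within_continuous => x; rewrite in_itv/= => /andP[ax _].
  exact/ex_derive/Df/neq0.
- by rewrite in_itv/= => xab ->; exists x.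
Qed.

(** The derivative of [gain'] is nonpositive because [cos x <= sinc x <= 1 <= sin x + cos x], which
    gives [0 <= sinc x - cos x <= sin x]. *)
Lemma gain'_le t u : 0 < t -> t <= u -> u <= pi / 2 -> gain' u <= gain' t.
Proof.
move=> t0; rewrite le_eqVlt => /predU1P[->//|tu] u2.
have [x /andP[tx xu]] := mvt_gt0 _ _ _ _ is_derive_gain' t0 tu.
have x0 : 0 < x by exact: lt_trans tx.
have x2 : x < pi / 2 by exact: lt_le_trans u2.
have p0 := @pi_gt0 R.
have sx0 : 0 < sin x by apply: sin_gt0_pi; rewrite x0/=; lra.
have cx0 : 0 < cos x by apply: cos_gt0_pihalf; rewrite x2 andbT; lra.
have cs : cos x <= sinc x.
  by rewrite /sinc ler_pdivlMr// mulrC mul_cos_le_sin//; lra.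
have sc1 : 1 <= sin x + cos x.
  have := cos2Dsin2 x => E; have := mulr_gt0 sx0 cx0 => F.
  by rewrite -(@ler_sqr R) ?nnegrE ?addr_ge0 ?ltW// sqrrD expr1n; lra.
have scs : sinc x - cos x <= sin x.
  rewrite lerBlDr /sinc ler_pdivrMr// (le_trans (sin_le_id _ (ltW x0)))//.
  by rewrite ler_peMl// ltW.
have : (sinc x - cos x) ^+ 2 - sin x ^+ 2 <= 0.
  by rewrite subr_le0 ler_sqr ?nnegrE ?subr_ge0// ltW.
move=> H E; rewrite -subr_le0 E mulr_le0_ge0//; last by rewrite subr_ge0 ltW.
by rewrite mulr_ge0_le0// divr_ge0// ltW.
Qed.

(** Up to [pi / 2] this is concavity of [gain]. Concavity fails near [pi]; past [pi / 2] the graph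
    still lies below the tangent at [pi / 2], whose slope [- (4 / pi ^+ 2)] is at most [gain' h], so
    the comparison passes through [pi / 2]. *)
Lemma gain_le_tangent h t : 0 < h -> h <= pi / 2 -> 0 < t -> t <= pi ->
  gain t - gain' h * t <= gain h - gain' h * h.
Proof.
move=> h0 h2 t0 tpi; have p0 := @pi_gt0 R.
have le_half u : 0 < u -> u <= pi / 2 ->
    gain u - gain' h * u <= gain h - gain' h * h.
  move=> u0 u2; have [hu|uh|->//] := ltgtP h u.
  - have [x /andP[hx xu]] := mvt_gt0 _ _ _ _ is_derive_gain h0 hu.
    have : gain' x <= gain' h by apply: gain'_le => //; lra.
    have : 0 < u - h by lra.
    by move=> /ltW/ler_wpM2r H /H; lra.
  - have [x /andP[ux xh]] := mvt_gt0 _ _ _ _ is_derive_gain u0 uh.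
    have : gain' h <= gain' x by apply: gain'_le; lra.
    have : 0 < h - u by lra.
    by move=> /ltW/ler_wpM2r H /H; lra.
have [/le_half->//|t2] := leP t (pi / 2).
have g'h : - (4 / pi ^+ 2) <= gain' h.
  have -> : - (4 / pi ^+ 2) = gain' (pi / 2).
    rewrite /gain' /sinc sin_pihalf cos_pihalf.
    by move: (@pi R) p0 => p p0; field; exact: lt0r_neq0.
  exact: gain'_le.
have p20 : 0 < pi / 2 :> R by rewrite divr_gt0.
apply: le_trans (le_half _ p20 (lexx _)).
have : gain t <= 4 / pi ^+ 2 * (pi - t).
  by rewrite /gain mulrA -expr2 sqr_sin_le// ltW.
have -> : gain (pi / 2) = 4 / pi ^+ 2 * (pi - pi / 2).
  rewrite /gain /sinc sin_pihalf.
  by move: (@pi R) p0 => p q; field; exact: lt0r_neq0.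
have : 0 <= (gain' h + 4 / pi ^+ 2) * (t - pi / 2).
  by apply: mulr_ge0; lra.
lra.
Qed.

End Trigonometry.

(** * Integrals of shifted cosines and of periodic functions *)

Section Integrals.
Context {R : realType}.
Local Notation mu := (@lebesgue_measure R).

Lemma is_derive_affine_sin (A B c x : R) :
  is_derive x 1 (fun y => A * y + B * sin (y + c)) (A + B * cos (x + c)).
Proof.
have Ds : is_derive x (1 : R) (fun y : R => sin (y + c)) (cos (x + c) * 1).
  have Dc : is_derive x (1 : R) (fun y : R => y + c) 1.
    by apply: is_derive_eq; rewrite addr0.
  exact: (@is_derive1_comp R sin (fun y => y + c)).
have DA := is_deriveZ A (is_derive_id x (1 : R)).
have D := is_deriveD DA (is_deriveZ B Ds).
by apply: is_derive_eq; rewrite /GRing.scale/= !mulr1.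
Qed.

Lemma continuous_affine_cos (A B c : R) :
  continuous (fun x => A + B * cos (x + c)).
Proof.
move=> x; apply: cvgD; first exact: cvg_cst.
apply: cvgMr.
apply: (continuous_comp (f := fun x => x + c)); last exact: continuous_cos.
by apply: cvgD; [exact: cvg_id|exact: cvg_cst].
Qed.

Lemma integral_affine_cos (a b A B c : R) : a <= b ->
  (\int[mu]_(x in `[a, b]) (A + B * cos (x + c))%:E =
   (A * (b - a) + B * (sin (b + c) - sin (a + c)))%:E)%E.
Proof.
rewrite le_eqVlt => /predU1P[->|ab].
  by rewrite set_itv1 integral_set1 !subrr !mulr0 addr0.
have cF : continuous (fun y => A * y + B * sin (y + c)).
  move=> x; apply/differentiable_continuous/derivable1_diffP.
  by have [] := is_derive_affine_sin A B c x.
rewrite (@continuous_FTC2 R _ (fun y => A * y + B * sin (y + c)))//.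
- by rewrite -EFinB; congr EFin; ring.
- exact/continuous_subspaceT/continuous_affine_cos.
- split.
  + by move=> x _; by have [] := is_derive_affine_sin A B c x.
  + exact/cvg_at_right_filter/cF.
  + exact/cvg_at_left_filter/cF.
- by move=> x _; rewrite derive1E; apply: derive_val; exact: is_derive_affine_sin.
Qed.

Lemma integral_translate (G : R -> R) (a b c : R) : a <= b -> continuous G ->
  (\int[mu]_(x in `[a, b]) (G (x + c))%:E =
   \int[mu]_(x in `[(a + c)%R, (b + c)%R]) (G x)%:E)%E.
Proof.
move=> ab cG.
have dF (x : R) : is_derive x (1 : R) (fun y : R => y + c) 1.
  by apply: is_derive_eq; rewrite addr0.
have F1 : derive1 (fun y : R => y + c) = cst 1.
  by apply/funext => x; rewrite derive1E; apply: derive_val.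
have cF : continuous (fun y : R => y + c).
  by move=> x; apply: cvgD; [exact: cvg_id|exact: cvg_cst].
rewrite (@integration_by_substitution_increasing R (fun y => y + c) G)//.
- by apply: eq_integral => x _; rewrite F1/= fctE mulr1.
- by move=> x y _ _ xy; rewrite ltrD2r.
- by rewrite F1 => x _; exact: cvg_cst.
- by rewrite F1; exact: is_cvg_cst.
- by rewrite F1; exact: is_cvg_cst.
- split => [x _| |].
  + by have [] := dF x.
  + exact/cvg_at_right_filter/cF.
  + exact/cvg_at_left_filter/cF.
- exact: continuous_subspaceT.
Qed.

(** The shared endpoint [b] is a null set; dropping it from the second interval makes the union
    disjoint. *)
Lemma ge0_integral_itv_split (f : R -> \bar R) (a b c : R) :
  a <= b -> b <= c -> measurable_fun setT f -> (forall x, 0 <= f x)%E ->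
  (\int[mu]_(x in `[a, c]) f x =
   \int[mu]_(x in `[a, b]) f x + \int[mu]_(x in `[b, c]) f x)%E.
Proof.
move=> ab bc mf f0.
have mE D : measurable_fun D f by exact: measurable_funTS.
rewrite -[X in (_ + X)%E]integral_itv_obnd_cbnd// -ge0_integral_setU//.
- by congr integral; rewrite -itv_bndbnd_setU.
- exact: mE.
- apply/eqP; rewrite -subset0 => x/=.
  by rewrite !in_itv/= => -[] /andP[_ xb] /andP[]; rewrite ltNge xb.
Qed.

(** The window [[c, T + c]] is cut at [T] and the part beyond [T] is moved back by one period. *)
Lemma integral_periodic (f : R -> R) (T c : R) : 0 <= c -> c <= T ->
  continuous f -> (forall x, 0 <= f x) -> periodic f T ->
  (\int[mu]_(x in `[0%R, T]) (f (x + c))%:E = \int[mu]_(x in `[0%R, T]) (f x)%:E)%E.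
Proof.
move=> c0 cT cf f0 pf.
have mf : measurable_fun setT (EFin \o f).
  by apply/measurable_EFinP; exact: continuous_measurable_fun.
rewrite integral_translate ?(le_trans c0)// add0r.
rewrite (@ge0_integral_itv_split (EFin \o f) _ T)//; last by rewrite lerDl.
rewrite [RHS](@ge0_integral_itv_split (EFin \o f) _ c)// addeC; congr (_ + _)%E.
have := @integral_translate f 0 c T c0 cf; rewrite add0r addrC => <-.
by apply: eq_integral => x _; rewrite pf.
Qed.

End Integrals.

(** * The positive part of [A + B * cos x] over one period *)

Section PositivePart.
Context {R : realType}.
Local Notation mu := (@lebesgue_measure R).

Lemma cos_2piB (x : R) : cos (2 * pi - x) = cos x.
Proof. by rewrite addrC mulr_natl cosD2pi cosN. Qed.

Lemma sin_2piB (x : R) : sin (2 * pi - x) = - sin x.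
Proof. by rewrite addrC mulr_natl sinD2pi sinN. Qed.

Lemma continuous_pos_part (f : R -> R) :
  continuous f -> continuous (fun x => Num.max 0 (f x)).
Proof. by move=> cf x; apply: continuous_max; [exact: cvg_cst|exact: cf]. Qed.

(* [x] is within [t] of [0] modulo [2 * pi] exactly when [cos t <= cos x]. *)
Lemma integral_pos_part_support (A B t : R) : 0 <= t -> t <= pi ->
  (forall x, cos t <= cos x -> 0 <= A + B * cos x) ->
  (forall x, cos x <= cos t -> A + B * cos x <= 0) ->
  (\int[mu]_(x in `[0%R, (2 * pi)%R]) (Num.max 0 (A + B * cos x))%:E =
   (2 * (A * t + B * sin t))%:E)%E.
Proof.
move=> t0 tpi pos neg; have p0 := @pi_gt0 R.
have int_pos (a b : R) : a <= b -> (forall x, a <= x <= b -> cos t <= cos x) ->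
    (\int[mu]_(x in `[a, b]) (Num.max 0 (A + B * cos x))%:E =
     (A * (b - a) + B * (sin b - sin a))%:E)%E.
  move=> ab cab; have := integral_affine_cos a b A B 0 ab.
  rewrite !addr0 => <-; apply: eq_integral => x; rewrite inE/= in_itv/= => xab.
  by rewrite addr0; congr EFin; apply/max_idPr/pos/cab.
pose f (x : R) := (Num.max 0 (A + B * cos x))%:E.
have f0 x : (0 <= f x)%E by rewrite lee_fin le_max lexx.
have mf : measurable_fun setT f.
  apply/measurable_EFinP; apply: continuous_measurable_fun.
  apply: continuous_pos_part => x.
  apply: cvgD; first exact: cvg_cst.
  by apply: cvgMr; exact: continuous_cos.
(* The integrand is cut at [t] and [2 * pi - t]: it vanishes on the middle piece, and the reflection
   [2 * pi - x] handles arguments beyond [pi]. *)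
rewrite (@ge0_integral_itv_split _ f _ t)//; last lra.
rewrite (@ge0_integral_itv_split _ f t (2 * pi - t))//; [|lra..].
rewrite (int_pos 0 t)// ?(int_pos (2 * pi - t))//; last 3 first.
- lra.
- by move=> x /andP[xt x2]; rewrite -(cos_2piB x) ler_cos_0pi//; lra.
- by move=> x /andP[x0 xt]; rewrite ler_cos_0pi.
rewrite (_ : (\int[mu]_(x in `[t, (2 * pi - t)%R]) _ = 0)%E); last first.
  apply: integral0_eq => x/=; rewrite in_itv/= => /andP[tx xt].
  congr EFin; apply/max_idPl/neg.
  have [xpi|/ltW pix] := leP x pi; first by rewrite ler_cos_0pi.
  by rewrite -(cos_2piB x) ler_cos_0pi//; lra.
have s2 : sin (2 * pi) = 0 :> R by rewrite mulr_natl sin2pi.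
rewrite add0e -EFinD sin_2piB sin0 s2; congr EFin; ring.
Qed.

(** The half-angle [t] is 0 when the positive part vanishes, [pi] when nothing is cut off, and
    otherwise the zero [acos (- A / B)] of the integrand. *)
Lemma integral_pos_part_cos (A B : R) : 0 <= B ->
  exists2 t, 0 <= t <= pi &
  (\int[mu]_(x in `[0%R, (2 * pi)%R]) (Num.max 0 (A + B * cos x))%:E =
   (2 * (A * t + B * sin t))%:E)%E.
Proof.
move=> B0; have p0 := @pi_ge0 R.
have [AB|AB] := leP (A + B) 0.
  exists 0; first by rewrite lexx.
  rewrite sin0 !mulr0 addr0 mulr0; apply: integral0_eq => x _.
  congr EFin; apply/max_idPl; have := ler_wpM2l B0 (cos_le1 x); lra.
have [BA|BA] := leP B A.
  exists pi; first by rewrite p0 lexx.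
  rewrite (_ : A * pi + _ = A * pi); last by rewrite sinpi mulr0 addr0.
  have := integral_affine_cos 0 (2 * pi) A B 0 (mulr_ge0 (ler0n _ 2) p0).
  rewrite !addr0 (_ : sin (2 * pi) = 0); last by rewrite mulr_natl sin2pi.
  rewrite sin0 !subr0 mulr0 addr0 mulrCA => <-.
  apply: eq_integral => x _; rewrite addr0; congr EFin; apply/max_idPr.
  by have := ler_wpM2l B0 (cos_geN1 x); lra.
have B0' : 0 < B by lra.
have k1 : -1 <= - A / B <= 1.
  by rewrite ler_pdivlMr// ler_pdivrMr//; apply/andP; split; lra.
have ck : cos (acos (- A / B)) = - A / B by rewrite acosK// in_itv.
exists (acos (- A / B)); first by rewrite acos_ge0// acos_lepi.
apply: integral_pos_part_support.
- exact: acos_ge0.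
- exact: acos_lepi.
- by move=> x; rewrite ck ler_pdivrMr//; lra.
- by move=> x; rewrite ck ler_pdivlMr//; lra.
Qed.

(* With the support [-t, t] fixed, the integral is maximal at
   [rho = sinc t], where it equals [2 * (gain t - gain' h * t)]. *)
Lemma integral_pos_part_le (h rho : R) : 0 < h -> h <= pi / 2 -> 0 <= rho ->
  (\int[mu]_(x in `[0%R, (2 * pi)%R])
     (Num.max 0 (- gain' h - rho ^+ 2 + 2 * rho * cos x))%:E <=
   (2 * (gain h - gain' h * h))%:E)%E.
Proof.
move=> h0 h2 rho0.
have [t /andP[]] := integral_pos_part_cos (- gain' h - rho ^+ 2) (2 * rho)
  (mulr_ge0 (ler0n _ 2) rho0).
(* For [t = 0] the integral is zero, and it remains to see that the bound is nonnegative. *)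
rewrite le_eqVlt => /predU1P[<- _ ->|t0 tpi ->].
  rewrite lee_fin sin0 !mulr0 addr0 mulr0 mulr_ge0//.
  have -> : gain h - gain' h * h = 2 * sin h * (sinc h - cos h).
    by rewrite /gain /gain' /sinc; field; exact: lt0r_neq0.
  have p0 := @pi_gt0 R.
  rewrite mulr_ge0// ?mulr_ge0// ?sin_ge0_pi ?(ltW h0)//=; first lra.
  by rewrite subr_ge0 /sinc ler_pdivlMr// mulrC mul_cos_le_sin//; lra.
(* The tangent inequality maximizes over [t]; completing the square maximizes over [rho], with
   defect [t * (rho - sinc t) ^+ 2]. *)
rewrite lee_fin ler_pM2l//; apply: le_trans (gain_le_tangent _ _ h0 h2 t0 tpi).
have : 0 <= t * (rho - sinc t) ^+ 2 by rewrite mulr_ge0 ?sqr_ge0// ltW.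
have -> : t * (rho - sinc t) ^+ 2 = rho ^+ 2 * t - 2 * rho * sin t + gain t.
  by rewrite /gain /sinc; field; exact: lt0r_neq0.
lra.
Qed.

End PositivePart.

(** * Squared distance to a finite set and its pointwise lower bound *)

Section Distance.
Context {R : realType}.
Implicit Types a x : R * R.

Lemma eucl_dist_sqr x a :
  eucl_dist x a ^+ 2 = (x.1 - a.1) ^+ 2 + (x.2 - a.2) ^+ 2.
Proof. by rewrite sqr_sqrtr// addr_ge0 ?sqr_ge0. Qed.

Lemma measurable_eucl_dist_sqr a :
  measurable_fun [set: R * R] (fun x => eucl_dist x a ^+ 2).
Proof.
under eq_fun do rewrite eucl_dist_sqr.
by apply: measurable_funD; apply: measurable_funX; apply: measurable_funB.
Qed.

Lemma measurable_min_sq_dist (A : {fset R * R}) :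
  measurable_fun [set: R * R] (min_sq_dist A).
Proof.
rewrite /min_sq_dist; elim: (enum_fset A) => [|a s IH].
  by apply: eq_measurable_fun (measurable_cst +oo%E) => x _; rewrite big_nil.
apply: (eq_measurable_fun (fun x =>
  mine (eucl_dist x a ^+ 2)%:E (\big[mine/+oo%E]_(b <- s) (eucl_dist x b ^+ 2)%:E))).
  by move=> x _; rewrite big_cons.
apply: measurable_mine => //; apply/measurable_EFinP.
exact: measurable_eucl_dist_sqr.
Qed.

Lemma min_sq_dist_ge0 (A : {fset R * R}) x : (0 <= min_sq_dist A x)%E.
Proof.
rewrite /min_sq_dist; elim: (enum_fset A) => [|a s IH].
  by rewrite big_nil.
by rewrite big_cons le_min IH lee_fin sqr_ge0.
Qed.

Lemma min_sq_dist_le (A : {fset R * R}) a x : a \in A ->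
  (min_sq_dist A x <= (eucl_dist x a ^+ 2)%:E)%E.
Proof.
rewrite /min_sq_dist; have -> : (a \in A) = (a \in enum_fset A) by [].
elim: (enum_fset A) => [//|b s IH].
rewrite big_cons ge_min inE => /orP[/eqP->|/IH->]; by rewrite ?lexx ?orbT.
Qed.

Definition excess (lam : R) a x : R := Num.max 0 (lam - eucl_dist x a ^+ 2).

Lemma measurable_excess lam a : measurable_fun [set: R * R] (excess lam a).
Proof.
apply: measurable_maxr => //; apply: measurable_funB => //.
exact: measurable_eucl_dist_sqr.
Qed.

(** At a nearest point the minimum plus its own excess already reaches [lam], and the other excesses
    are nonnegative. The induction starts from the empty list, where the minimum is [+oo]. *)
Lemma le_min_sq_dist_excess (lam : R) (A : {fset R * R}) x :
  (lam%:E <= min_sq_dist A x + \sum_(a <- A) (excess lam a x)%:E)%E.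
Proof.
have e0 a : (0 <= (excess lam a x)%:E)%E by rewrite lee_fin le_max lexx.
rewrite /min_sq_dist; elim: (enum_fset A) => [|a s IH].
  by rewrite !big_nil addye// leey.
have s0 : (0 <= \sum_(a <- s) (excess lam a x)%:E)%E by exact: sume_ge0.
rewrite !big_cons minEle; case: ifPn => _; rewrite addeA.
  apply: lee_paddr => //; rewrite -EFinD lee_fin /excess.
  by rewrite -lerBlDl le_max lexx orbT.
by rewrite addeAC; exact: lee_paddr.
Qed.

End Distance.

(** * Polar coordinates and the bound for one point *)

Section Circle.
Context {R : realType}.
Local Notation mu := (@lebesgue_measure R).
Variable r : R.
Hypothesis r0 : 0 < r.

Lemma integral_circle (f : R * R -> \bar R) :
  measurable_fun [set: R * R] f -> (forall x, 0 <= f x)%E ->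
  (\int[circle_uniform r]_x f x =
   ((2 * pi)^-1)%:E * \int[mu]_(x in `[0%R, (2 * pi)%R]) f (circle_param r x))%E.
Proof.
move=> mf f0; rewrite ge0_integral_distribution// integral_uniform ?subr0//.
  by apply: measurableT_comp => //; exact: measurable_circle_param.
by move=> x; exact: f0.
Qed.

(** Law of cosines. The point carries the angle [- c], so that [c] enters as a shift [x + c], the
    form treated by [integral_periodic]. *)
Lemma eucl_dist_circle (rho c x : R) :
  eucl_dist (circle_param r x) (r * (rho * cos c), - (r * (rho * sin c))) ^+ 2 =
  r ^+ 2 * (1 + rho ^+ 2 - 2 * rho * cos (x + c)).
Proof.
rewrite eucl_dist_sqr/= cosD.
have := cos2Dsin2 x; have := cos2Dsin2 c; move: (cos x) (sin x) (cos c) (sin c).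
move=> cx sx cc sc Ec Ex.
transitivity (r ^+ 2 * ((cx ^+ 2 + sx ^+ 2) + rho ^+ 2 * (cc ^+ 2 + sc ^+ 2)
  - 2 * rho * (cx * cc - sx * sc))); first ring.
by rewrite Ec Ex mulr1.
Qed.

Lemma polar (a : R * R) : exists rho c, [/\ 0 <= rho, 0 <= c <= 2 * pi &
  a = (r * (rho * cos c), - (r * (rho * sin c)))].
Proof.
case: a => p q; have p0 := @pi_ge0 R.
set d := Num.sqrt (p ^+ 2 + q ^+ 2).
have d0 : 0 <= d by exact: sqrtr_ge0.
have d2 : d ^+ 2 = p ^+ 2 + q ^+ 2 by rewrite sqr_sqrtr// addr_ge0 ?sqr_ge0.
suff [c c2 [-> ->]] : exists2 c, 0 <= c <= 2 * pi &
    p = d * cos c /\ q = - (d * sin c).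
  exists (d / r), c; split => //; first by rewrite divr_ge0// ltW.
  by congr pair; field; exact: lt0r_neq0.
have [dE|dN] := eqVneq d 0.
  exists 0; first by rewrite lexx mulr_ge0.
  move: d2; rewrite dE expr0n/= !mul0r oppr0 => /esym/eqP.
  by rewrite paddr_eq0 ?sqr_ge0// !sqrf_eq0 => /andP[/eqP-> /eqP->].
have dp : 0 < d by rewrite lt_neqAle eq_sym dN.
have k1 : -1 <= p / d <= 1.
  have : `|p| <= d by rewrite -sqrtr_sqr ler_wsqrtr// lerDl sqr_ge0.
  by rewrite ler_norml ler_pdivlMr// ler_pdivrMr// mulN1r mul1r.
have sk : d * sin (acos (p / d)) = `|q|.
  rewrite sin_acos// -[X in X * _](ger0_norm d0) -sqrtr_sqr -sqrtrM ?sqr_ge0//.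
  rewrite -sqrtr_sqr; congr Num.sqrt.
  by rewrite mulrBr mulr1 -exprMn mulrC divfK// d2; ring.
have ck : d * cos (acos (p / d)) = p.
  by rewrite acosK ?in_itv//= mulrC divfK.
have [a0 api] := (acos_ge0 k1, acos_lepi k1).
(* [acos (p / d)] determines [q] only up to sign; as the second coordinate is [- (d * sin c)], a
   nonnegative [q] takes the reflected angle. *)
have [q0|q0] := leP 0 q.
  exists (2 * pi - acos (p / d)); first by apply/andP; split; lra.
  by rewrite cos_2piB sin_2piB mulrN opprK sk ck ger0_norm.
exists (acos (p / d)); first by apply/andP; split; lra.
by rewrite sk ck ltr0_norm// opprK.
Qed.

(* [r ^+ 2 * (1 - gain' h)] is [r ^+ 2 * (1 + s ^+ 2 - 2 * s * cos h)] for
   [s = sinc h]. *)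
Lemma integral_excess_le (h : R) (a : R * R) : 0 < h -> h <= pi / 2 ->
  (\int[circle_uniform r]_x
     (excess (r ^+ 2 * (1 - gain' h)) a x)%:E <=
   (r ^+ 2 / pi * (gain h - gain' h * h))%:E)%E.
Proof.
move=> h0 h2; have p0 := @pi_gt0 R.
have [rho [c [rho0 /andP[c0 c2] aE]]] := polar a.
rewrite integral_circle; last 2 first.
- by apply/measurable_EFinP; exact: measurable_excess.
- by move=> x; rewrite lee_fin le_max lexx.
pose f (x : R) := Num.max 0 (- gain' h - rho ^+ 2 + 2 * rho * cos x).
have f0 x : 0 <= f x by rewrite le_max lexx.
have cf : continuous f.
  apply: continuous_pos_part => x; apply: cvgD; first exact: cvg_cst.
  by apply: cvgMr; exact: continuous_cos.
have mf : measurable_fun setT f by exact: continuous_measurable_fun.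
have mfc : measurable_fun setT (fun x : R => f (x + c)).
  apply: continuous_measurable_fun => x.
  apply: (continuous_comp (f := fun x => x + c)); last exact: cf.
  by apply: cvgD; [exact: cvg_id|exact: cvg_cst].
(* By the law of cosines the excess is [r ^+ 2] times [f] shifted by [c]; periodicity then removes
   the shift. *)
rewrite (_ : (\int[mu]_(x in _) _ =
    \int[mu]_(x in `[0%R, (2 * pi)%R]) ((r ^+ 2)%:E * (f (x + c))%:E))%E);
  last first.
  apply: eq_integral => x _; rewrite -EFinM; congr EFin.
  rewrite aE /excess eucl_dist_circle.
  rewrite /f maxr_pMr ?sqr_ge0// mulr0.
  by congr Num.max; ring.
rewrite ge0_integralZl_EFin ?sqr_ge0//; last 2 first.
- by move=> x _; rewrite lee_fin.
- by apply/measurable_EFinP; exact: measurable_funTS.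
rewrite integral_periodic//; last first.
  by move=> x; rewrite /f (mulr_natl pi 2) cosD2pi.
have := integral_pos_part_le h rho h0 h2 rho0.
have r20 : (0 <= ((2 * pi)^-1 * r ^+ 2)%:E)%E.
  by rewrite lee_fin mulr_ge0 ?sqr_ge0// invr_ge0 mulr_ge0 ?ltW.
move=> /(lee_wpmul2l r20); rewrite EFinM -muleA => /le_trans; apply.
rewrite -!EFinM lee_fin le_eqVlt; apply/orP; left; apply/eqP.
by move: (@pi R) p0 => p q; field; exact: lt0r_neq0.
Qed.

End Circle.

(** * Lower bound for all sets and upper bound for the regular configuration *)

Section Distortion.
Context {R : realType}.
Local Notation mu := (@lebesgue_measure R).
Variable r : R.
Hypothesis r0 : 0 < r.

(** Integrating [le_min_sq_dist_excess] leaves at most [n] excess integrals, each bounded by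
    [integral_excess_le]. *)
Lemma distortion_ge (h : R) (n : nat) (A : {fset R * R}) :
  0 < h -> h <= pi / 2 -> (#|` A| <= n)%N ->
  ((r ^+ 2 * (1 - gain' h) -
     n%:R * (r ^+ 2 / pi * (gain h - gain' h * h)))%:E <=
   distortion (circle_uniform r) A)%E.
Proof.
move=> h0 h2 An.
set lam := r ^+ 2 * (1 - gain' h); set K := r ^+ 2 / pi * _.
have e0 a x : (0 <= (excess lam a x)%:E)%E by rewrite lee_fin le_max lexx.
have me a : measurable_fun [set: R * R] (fun x => (excess lam a x)%:E).
  by apply/measurable_EFinP; exact: measurable_excess.
(* The sign of [K] lets the cardinality of [A] be replaced by [n]; it follows from the one-point
   bound at the origin. *)
have K0 : 0 <= K.
  rewrite -lee_fin; apply: le_trans (integral_excess_le r r0 h (0, 0) h0 h2).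
  by apply: integral_ge0 => x _.
have lamE : (\int[circle_uniform r]_x lam%:E = lam%:E)%E.
  rewrite integral_cst// -[RHS]mule1; congr (_ * _)%E.
  exact: (probability_setT (circle_uniform r)).
rewrite EFinB leeBlDr// -[leLHS]lamE.
apply: (@le_trans _ _ (\int[circle_uniform r]_x
    (min_sq_dist A x + \sum_(a <- A) (excess lam a x)%:E))%E).
  apply: ge0_le_integral => //.
  - move=> x _; rewrite lee_fin mulr_ge0 ?sqr_ge0//.
    have -> : 1 - gain' h = (sinc h - cos h) ^+ 2 + (1 - cos h ^+ 2).
      by rewrite /gain'; ring.
    by rewrite -sin2cos2 addr_ge0 ?sqr_ge0.
  - apply: emeasurable_funD; first exact: measurable_min_sq_dist.
    exact: emeasurable_sum.
  - by move=> x _; exact: le_min_sq_dist_excess.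
rewrite ge0_integralD//; last 4 first.
- by move=> x _; exact: min_sq_dist_ge0.
- exact: measurable_min_sq_dist.
- by move=> x _; exact: sume_ge0.
- exact: emeasurable_sum.
rewrite leeD2l// ge0_integral_sum//.
apply: (@le_trans _ _ (\sum_(a <- A) K%:E)%E).
  by apply: lee_sum => a _; exact: integral_excess_le.
rewrite sumEFin lee_fin big_const_seq count_predT iter_addr_0 -[leLHS]mulr_natl.
by rewrite ler_wpM2r// ler_nat.
Qed.

(** The cosine term integrates to zero over a full turn, leaving [r ^+ 2 * (1 + rho ^+ 2)]. This
    covers [n = 1], where [h = pi] exceeds [pi / 2]. *)
Lemma distortion_ge1 (A : {fset R * R}) : #|` A| = 1%N ->
  ((r ^+ 2)%:E <= distortion (circle_uniform r) A)%E.
Proof.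
move=> A1; have p0 := @pi_gt0 R.
rewrite /distortion integral_circle; last 2 first.
- exact: measurable_min_sq_dist.
- exact: min_sq_dist_ge0.
rewrite /min_sq_dist; case: (enum_fset A) A1 => [//|a [|//]] _.
have [rho [c [rho0 _ ->]]] := polar r r0 a.
rewrite (_ : (\int[mu]_(x in _) _ = \int[mu]_(x in `[0%R, (2 * pi)%R])
    (r ^+ 2 * (1 + rho ^+ 2) + (- (2 * r ^+ 2 * rho)) * cos (x + c))%:E)%E).
  rewrite integral_affine_cos; last by rewrite mulr_ge0// ltW.
  rewrite [2 * pi + c]addrC (mulr_natl pi 2) sinD2pi add0r subrr mulr0 addr0 subr0.
  rewrite -EFinM lee_fin mulrCA mulVf ?mulr1; last first.
    by rewrite lt0r_neq0// pmulrn_lgt0.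
  by rewrite ler_pMr ?exprn_gt0// lerDl sqr_ge0.
apply: eq_integral => x _; rewrite big_seq1 eucl_dist_circle; congr EFin; ring.
Qed.

Lemma circle_mean_polar (n j : nat) (h := pi / n%:R) (m := (2 * j%:R - 1) * h) :
  (0 < n)%N -> circle_mean r n j =
    (r * (sinc h * cos (- m)), - (r * (sinc h * sin (- m)))).
Proof.
move=> n0; rewrite cosN sinN !mulrN opprK /circle_mean /sinc -/h -/m.
have n0' : n%:R != 0 :> R by rewrite pnatr_eq0 -lt0n.
rewrite (_ : n%:R * r / pi = r / h); first by congr pair; ring.
have p0 := @pi_gt0 R; rewrite /h; move: (@pi R) p0 => p q.
by field; rewrite n0' lt0r_neq0.
Qed.

(** On each arc of half-angle [h] the minimum is bounded by the squared distance to the mean on the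
    arc's axis. *)
Lemma integral_arc_le (n j : nat) (h := pi / n%:R) : (0 < n)%N -> (j < n)%N ->
  (\int[mu]_(x in `[(2 * h * j%:R)%R, (2 * h * j.+1%:R)%R])
     min_sq_dist (circle_means r n) (circle_param r x) <=
   (2 * h * (r ^+ 2 * (1 - sinc h ^+ 2)))%:E)%E.
Proof.
move=> n0 jn; have p0 := @pi_gt0 R.
have h0 : 0 < h by rewrite divr_gt0// ltr0n.
(* Arcs are counted from 0 and means from 1, so the midpoint of arc [j] is the angle of mean
   [j.+1]. *)
pose m : R := (2 * j.+1%:R - 1) * h.
apply: (@le_trans _ _ (\int[mu]_(x in `[(2 * h * j%:R)%R, (2 * h * j.+1%:R)%R])
  (r ^+ 2 * (1 + sinc h ^+ 2) + (- (2 * r ^+ 2 * sinc h)) * cos (x + - m))%:E)%E).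
  apply: ge0_le_integral => //.
  - by move=> x _; exact: min_sq_dist_ge0.
  - apply: measurable_funTS; apply: measurableT_comp.
      exact: measurable_min_sq_dist.
    exact: measurable_circle_param.
  - apply: measurable_funTS; apply/measurable_EFinP.
    by apply: continuous_measurable_fun; exact: continuous_affine_cos.
  - move=> x _; have := @min_sq_dist_le R (circle_means r n)
      (circle_mean r n j.+1) (circle_param r x).
    rewrite circle_mean_polar// eucl_dist_circle -/h -/m => /(_ _)/le_trans; apply.
      rewrite -circle_mean_polar//; apply: in_imfset => /=.
      by rewrite mem_iota add1n.
    by rewrite lee_fin le_eqVlt; apply/orP; left; apply/eqP; ring.
rewrite integral_affine_cos; last first.
  by rewrite ler_pM2l; [rewrite ler_nat|rewrite mulr_gt0].
rewrite (_ : _ - m = h); last by rewrite /m; ring.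
rewrite (_ : _ - m = - h); last by rewrite /m -natr1; ring.
rewrite lee_fin sinN -natr1 le_eqVlt; apply/orP; left; apply/eqP.
by rewrite /sinc; field; exact: lt0r_neq0.
Qed.

Lemma distortion_circle_means_le (n : nat) (h := pi / n%:R) : (0 < n)%N ->
  (distortion (circle_uniform r) (circle_means r n) <=
   (r ^+ 2 * (1 - sinc h ^+ 2))%:E)%E.
Proof.
move=> n0; have p0 := @pi_gt0 R.
have h0 : 0 < h by rewrite divr_gt0// ltr0n.
pose f (x : R) := min_sq_dist (circle_means r n) (circle_param r x).
have f0 x : (0 <= f x)%E by exact: min_sq_dist_ge0.
have mf : measurable_fun setT f.
  apply: measurableT_comp; first exact: measurable_min_sq_dist.
  exact: measurable_circle_param.
pose W := 2 * h * (r ^+ 2 * (1 - sinc h ^+ 2)).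
have int_le k : (k <= n)%N ->
    (\int[mu]_(x in `[0%R, (2 * h * k%:R)%R]) f x <= (k%:R * W)%:E)%E.
  elim: k => [_|k IH kn]; first by rewrite mulr0 set_itv1 integral_set1 mul0r.
  rewrite (@ge0_integral_itv_split _ f _ (2 * h * k%:R))//; last 2 first.
  - by rewrite !mulr_ge0// ltW.
  - by rewrite ler_pM2l; [rewrite ler_nat|rewrite mulr_gt0].
  rewrite [leRHS](_ : _ = (k%:R * W)%:E + W%:E)%E; last first.
    by rewrite -EFinD -natr1 mulrDl mul1r.
  rewrite leeD ?IH ?(ltnW kn)//.
  exact: integral_arc_le.
rewrite /distortion integral_circle; last 2 first.
- exact: measurable_min_sq_dist.
- exact: min_sq_dist_ge0.
have := int_le n (leqnn n).
(* The [n] arcs of length [2 * h] fill [[0, 2 * pi]] exactly. *)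
have hE : h * n%:R = pi by rewrite divfK// pnatr_eq0 -lt0n.
rewrite -mulrA hE => H.
have p20 : (0 <= ((2 * pi)^-1 : R)%:E)%E.
  by rewrite lee_fin invr_ge0 mulr_ge0// ltW.
apply: le_trans (lee_wpmul2l p20 H) _.
rewrite -EFinM lee_fin le_eqVlt; apply/orP; left; apply/eqP.
rewrite /W -hE; field.
by apply/andP; split; [rewrite pnatr_eq0 -lt0n|exact: lt0r_neq0].
Qed.

Lemma card_circle_means (n : nat) : (0 < n)%N ->
  (1 <= #|` circle_means r n| <= n)%N.
Proof.
move=> n0; apply/andP; split.
  rewrite cardfs_gt0; apply/fset0Pn; exists (circle_mean r n 1).
  by apply: in_imfset; rewrite /= mem_iota/= add1n ltnS.
apply: leq_trans (leq_imfset_card _ _ _) _; rewrite -[leqRHS](size_iota 1).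
by apply: uniq_leq_size; [exact: enum_finmem_uniq|move=> j; rewrite enum_finmemE].
Qed.

End Distortion.

(** * Agreement of the lower and upper bounds *)

Theorem theorem4p2p1 (R : realType) (r : R) (hr : 0 < r) (n : nat)
    (hn : (1 <= n)%N) :
  optimal_n_means (circle_uniform r) n (circle_means r n) /\
  quantization_error (circle_uniform r) n =
    (r ^+ 2 * (1 - n%:R ^+ 2 / pi ^+ 2 * sin (pi / n%:R) ^+ 2))%:E.
Proof.
have p0 := @pi_gt0 R; pose h : R := pi / n%:R.
have n0' : 0 < n%:R :> R by rewrite ltr0n.
have h0 : 0 < h by rewrite divr_gt0.
rewrite (_ : _ * (1 - _) = r ^+ 2 * (1 - sinc h ^+ 2)); last first.
  rewrite /sinc /h; move: (sin _) => s; move: (@pi R) p0 => p q.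
  by field; rewrite !lt0r_neq0.
have lower (A : {fset R * R}) : (1 <= #|` A| <= n)%N ->
    ((r ^+ 2 * (1 - sinc h ^+ 2))%:E <= distortion (circle_uniform r) A)%E.
  move=> /andP[A1 An]; have [n1|n2] := leqP n 1.
    have n1' : n = 1%N by apply/eqP; rewrite eqn_leq n1.
    have A1' : #|` A| = 1%N by apply/eqP; rewrite eqn_leq A1 -n1' An.
    apply: le_trans (distortion_ge1 r hr A A1').
    by rewrite lee_fin /h n1' divr1 /sinc sinpi mul0r expr0n/= subr0 mulr1.
  have h2 : h <= pi / 2 by rewrite ler_pM2l// lef_pV2 ?posrE// ler_nat.
  apply: le_trans (distortion_ge r hr h n A h0 h2 An).
  rewrite lee_fin le_eqVlt; apply/orP; left; apply/eqP.
  (* Since [n / pi = 1 / h], the subtracted term is [r ^+ 2 * (sinc h ^+ 2 - gain' h)], and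
     [gain' h] cancels. *)
  have hE : pi = h * n%:R by rewrite divfK// lt0r_neq0.
  rewrite hE /gain /sinc; field.
  by rewrite !lt0r_neq0.
have upper := distortion_circle_means_le r n hn.
have qE : quantization_error (circle_uniform r) n =
    (r ^+ 2 * (1 - sinc h ^+ 2))%:E.
  apply/eqP; rewrite eq_le; apply/andP; split.
    apply: le_trans upper; apply: ereal_inf_lbound.
    by exists (circle_means r n) => //; exact: card_circle_means.
  by apply: le_ereal_inf_tmp => _ [A /= A1n <-]; exact: lower.
split => //; split; first exact: card_circle_means.
by rewrite qE; apply/eqP; rewrite eq_le upper lower// card_circle_means.
Qed.
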